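(* Let $\mathbb{F}$ be a field of characteristic either $0$ or a fixed prime $p$. For any positive $n\in\mathbb{N}$, $t\in[0,n]$, any $(n,t)$-threshold tuple $T$ and any $\varepsilon\in(0,1/3)$, $$\mathrm{pdeg}_\varepsilon(T)=\begin{cases}\widetilde{O}(\sqrt{t\log(1/\varepsilon)}+\log(1/\varepsilon)), & \mathrm{char}(\mathbb{F})=0,\\ O(\sqrt{t\log(1/\varepsilon)}+\log(1/\varepsilon)), & \mathrm{char}(\mathbb{F})=p>0,\end{cases}$$ where $\widetilde{O}$ hides factors polylogarithmic in $n$.
   Context: $\mathrm{Thr}^t_n:\{0,1\}^n\to\{0,1\}$ accepts exactly the inputs of Hamming weight at least $t$. An $(n,t)$-threshold tuple is a tuple $(\mathrm{Thr}_n^{t_1},\dots,\mathrm{Thr}_n^{t_m})$ with $t_1,\dots,t_m\in[0,t]$. For an $m$-tuple $f=(f_1,\dots,f_m)$ of Boolean functions on $\{0,1\}^n$, an $\varepsilon$-error probabilistic poly-tuple is a random $m$-tuple $\mathbf{P}$ of polynomials in $\mathbb{F}[X_1,\dots,X_n]^m$ (finitely supported distribution) with $\Pr[\mathbf{P}(x)\ne f(x)]\le\varepsilon$ for all $x\in\{0,1\}^n$; its degree is at most $d$ if every tuple in the support consists of polynomials of degree at most $d$; $\mathrm{pdeg}_\varepsilon(f)$ is the least such $d$. Constants in $O(\cdot)$ may depend on $p$. *)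

(* Defs.v *)
From HB Require Import structures.
From mathcomp Require Import all_boot all_order all_algebra finmap.
From mathcomp Require Import mpoly.
From mathcomp Require Import boolp reals exp.

Set Implicit Arguments.
Unset Strict Implicit.
Unset Printing Implicit Defensive.

Import Order.TTheory GRing.Theory Num.Theory.
Local Open Scope ring_scope.

Definition boolfun (n : nat) : Type := n.-tuple bool -> bool.

Definition hamming_weight (n : nat) (x : n.-tuple bool) : nat := count id x.

Definition Thr (n t : nat) : boolfun n := fun x => (t <= hamming_weight x)%N.

Definition threshold_tuple (n t m : nat) (T : m.-tuple (boolfun n)) : Prop :=
  exists ts : m.-tuple nat,
    (forall i : 'I_m, (tnth ts i <= t)%N) /\ T = [tuple Thr (tnth ts i) | i < m].

Definition poly_tuple (F : fieldType) (n m : nat) := m.-tuple {mpoly F[n]}.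

Record random_poly_tuple (R : realType) (F : fieldType) (n m : nat) :=
  RandomPolyTuple {
    mass :> {fsfun poly_tuple F n m -> R with 0};
    mass_ge0 : forall P, 0 <= mass P;
    mass_sum1 : \sum_(P <- finsupp mass) mass P = 1
  }.

Definition Pr (R : realType) (F : fieldType) (n m : nat)
    (mu : random_poly_tuple R F n m) (E : pred (poly_tuple F n m)) : R :=
  \sum_(P <- finsupp mu | E P) mu P.

Definition eval_tuple (F : fieldType) (n m : nat) (P : poly_tuple F n m)
    (x : n.-tuple bool) : m.-tuple F :=
  [tuple (tnth P i).@[fun j => (tnth x j)%:R] | i < m].

Definition value_tuple (F : fieldType) (n m : nat) (f : m.-tuple (boolfun n))
    (x : n.-tuple bool) : m.-tuple F :=
  [tuple (tnth f i x)%:R | i < m].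

Definition error_le (R : realType) (F : fieldType) (n m : nat) (eps : R)
    (f : m.-tuple (boolfun n)) (mu : random_poly_tuple R F n m) : Prop :=
  forall x : n.-tuple bool,
    Pr mu (fun P => eval_tuple P x != value_tuple F f x) <= eps.

(* [msize p] is one more than the total degree of [p], and [msize 0 = 0]. *)
Definition degree_le (R : realType) (F : fieldType) (n m : nat) (d : nat)
    (mu : random_poly_tuple R F n m) : Prop :=
  forall P, P \in finsupp mu -> forall i : 'I_m, (msize (tnth P i) <= d.+1)%N.

Definition has_pdeg_le (R : realType) (F : fieldType) (n m : nat) (eps : R)
    (f : m.-tuple (boolfun n)) (d : nat) : Prop :=
  exists mu : random_poly_tuple R F n m, error_le eps f mu /\ degree_le d mu.

(* The default value 0 is never used when [0 <= eps]: see [pdegP]. *)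
Definition pdeg (R : realType) (F : fieldType) (n m : nat) (eps : R)
    (f : m.-tuple (boolfun n)) : nat :=
  if pselect (exists d, `[< has_pdeg_le F eps f d >]) is left h
  then ex_minn h else 0%N.

Definition indicator_poly (F : fieldType) (n : nat) (a : n.-tuple bool)
    : {mpoly F[n]} :=
  \prod_(j < n) (if tnth a j then 'X_j else 1 - 'X_j).

Lemma indicator_polyE (F : fieldType) (n : nat) (a x : n.-tuple bool) :
  (indicator_poly F a).@[fun j => (tnth x j)%:R] = (a == x)%:R.
Proof.
have factorE j : (if tnth a j then 'X_j else 1 - 'X_j : {mpoly F[n]}).@[
    fun j => (tnth x j)%:R] = (tnth a j == tnth x j)%:R.
  case: (tnth a j); rewrite ?mevalB ?meval1 mevalXU; case: (tnth x j) => //=.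
    by rewrite subrr.
  by rewrite subr0.
rewrite /indicator_poly rmorph_prod /= (eq_bigr _ (fun j _ => factorE j)).
have [<-|ax] := eqVneq a x; first by rewrite big1// => j _; rewrite eqxx.
have [j jP] : exists j, tnth a j != tnth x j.
  apply/existsP; apply: contraR ax; rewrite negb_exists => /forallP h.
  by apply/eqP/eq_from_tnth => j; apply/eqP; rewrite -[_ == _]negbK; exact: h.
by rewrite (bigD1 j)//= (negbTE jP) mul0r.
Qed.

Lemma poly_tuple_exact (F : fieldType) (n m : nat) (f : m.-tuple (boolfun n)) :
  exists P : poly_tuple F n m, forall x, eval_tuple P x = value_tuple F f x.
Proof.
exists [tuple \sum_(a : n.-tuple bool) (tnth f i a)%:R *: indicator_poly F a
       | i < m] => x.
apply: eq_from_tnth => i; rewrite !tnth_mktuple raddf_sum /=.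
rewrite (bigD1 x)//= mevalZ indicator_polyE eqxx mulr1 big1 ?addr0// => a ax.
by rewrite mevalZ indicator_polyE (negbTE ax) mulr0.
Qed.

Section Dirac.
Variables (R : realType) (F : fieldType) (n m : nat) (P : poly_tuple F n m).

Let dirac : {fsfun poly_tuple F n m -> R with 0} :=
  [fsfun [fsfun for fun=> 0] with P |-> 1].

Let diracE Q : dirac Q = (Q == P)%:R.
Proof. by rewrite /dirac fsfun_withE; case: eqVneq => //; rewrite fsfunE. Qed.

Let supp_dirac : finsupp dirac = [fset P]%fset.
Proof.
by apply/fsetP => Q; rewrite mem_finsupp diracE inE pnatr_eq0 eqb0 negbK.
Qed.

Let dirac_ge0 Q : 0 <= dirac Q. Proof. by rewrite diracE ler0n. Qed.

Let dirac_sum1 : \sum_(Q <- finsupp dirac) dirac Q = 1.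
Proof. by rewrite supp_dirac big_seq_fset1 diracE eqxx. Qed.

Lemma dirac_ex : exists mu : random_poly_tuple R F n m, finsupp mu = [fset P]%fset.
Proof. by exists (RandomPolyTuple dirac_ge0 dirac_sum1). Qed.

End Dirac.

Lemma has_pdeg_le_ex (R : realType) (F : fieldType) (n m : nat) (eps : R)
    (f : m.-tuple (boolfun n)) :
  0 <= eps -> exists d, `[< has_pdeg_le F eps f d >].
Proof.
move=> eps0; have [P PE] := poly_tuple_exact F f.
have [mu supp_mu] := dirac_ex R P.
exists (\max_(i < m) msize (tnth P i))%N; apply/asboolP; exists mu; split.
  by move=> x; rewrite /Pr supp_mu big_mkcond big_seq_fset1 /= PE eqxx.
by move=> Q; rewrite supp_mu inE => /eqP -> i; apply/leqW/leq_bigmax.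
Qed.

Lemma pdegP (R : realType) (F : fieldType) (n m : nat) (eps : R)
    (f : m.-tuple (boolfun n)) : 0 <= eps ->
  has_pdeg_le F eps f (pdeg F eps f) /\
  (forall d, has_pdeg_le F eps f d -> (pdeg F eps f <= d)%N).
Proof.
move=> eps0; rewrite /pdeg; case: pselect => [h|[]]; last exact: has_pdeg_le_ex.
by case: ex_minnP => d /asboolP hd dmin; split => // e he; apply/dmin/asboolP.
Qed.

(* Main.v *)
Require Import Defs.
From mathcomp Require Import all_boot all_order all_algebra finmap.
From mathcomp Require Import mpoly boolp reals sequences exp.
From mathcomp Require Import zify ring lra.

Set Implicit Arguments.
Unset Strict Implicit.
Unset Printing Implicit Defensive.

Import Order.TTheory GRing.Theory Num.Theory.
Local Open Scope ring_scope.

(* Identify inputs with subsets of [n], write the error as [exp(-l)], and compute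
   all thresholds up to [t] simultaneously. Keep each point with probability
   1/32. A threshold [i <= t = l r^2] is decided by the size of the sample
   unless the weight is within [O(l r)] of [i], where an exact interpolation
   polynomial of degree [O(l r)] takes over. The sample is treated recursively
   with [r] divided by 4 and [l + 1] for [l], so the degrees form a geometric
   series and sum to [O(l r)], which is [O(sqrt(t l) + l)].
   The recursion bottoms out at [t = O(l)]. In characteristic [p], weight at most
   [t] is told apart from weight [>> t] by voting over [O(l)] random sparse
   linear forms raised to the power [p - 1]. In general, nested samples down to
   constant expected size are combined by a product over [O(log n)] levels. *)

(** * Functions on subsets represented by low-degree polynomials *)

Section Degree.
Variables (F : fieldType) (n : nat).
Implicit Types (f g : {set 'I_n} -> F) (X S : {set 'I_n}).

(** Degree is tracked on functions of subsets, that is modulo [X_i ^ 2 = X_i], so no polynomial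
    identities are needed; [degle_mpoly] returns to actual polynomials. The slack in the indices of
    the first two constructors is what makes [degle_weak] provable. *)
Inductive degle : nat -> ({set 'I_n} -> F) -> Prop :=
| degle_const d c : degle d (fun=> c)
| degle_var d i : degle d.+1 (fun X => (i \in X)%:R)
| degle_add d f g : degle d f -> degle d g -> degle d (fun X => f X + g X)
| degle_mul d e f g :
    degle d f -> degle e g -> degle (d + e) (fun X => f X * g X).

Lemma degle_ext d f g : f =1 g -> degle d f -> degle d g.
Proof. by move=> /funext ->. Qed.

Lemma degle_weak d e f : (d <= e)%N -> degle d f -> degle e f.
Proof.
move=> + H; elim: H e => [{}d c|{}d i|{}d f1 g _ IHf _ IHg|{}d d' f1 g _ IHf _ IHg] e.
- by move=> _; exact: degle_const.
- by case: e => // e _; exact: degle_var.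
- by move=> de; apply: degle_add; [exact: IHf|exact: IHg].
- move=> de; have -> : e = (d + (e - d))%N by lia.
  by apply: degle_mul; [exact: IHf|apply: IHg; lia].
Qed.

Lemma degle_scale d c f : degle d f -> degle d (fun X => c * f X).
Proof. by move=> df; rewrite -[d]add0n; apply: degle_mul df; exact: degle_const. Qed.

Lemma degle_sub d f g : degle d f -> degle d g -> degle d (fun X => f X - g X).
Proof.
move=> df dg; apply: degle_add => //.
by apply: degle_ext (degle_scale (- 1) dg) => X; rewrite mulN1r.
Qed.

Lemma degle_sum d (I : Type) (r : seq I) (P : pred I) (h : I -> {set 'I_n} -> F) :
  (forall i, P i -> degle d (h i)) ->
  degle d (fun X => \sum_(i <- r | P i) h i X).
Proof.
move=> dh; elim: r => [|i r IH].
  by apply: (degle_ext _ (degle_const d 0)) => X; rewrite big_nil.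
case Pi : (P i); last by apply: degle_ext IH => X; rewrite big_cons Pi.
by apply: degle_ext (degle_add (dh i Pi) IH) => X; rewrite big_cons Pi.
Qed.

Lemma degle_prod k (I : finType) (A : {set I}) (h : I -> {set 'I_n} -> F) :
  (forall i, degle k (h i)) -> degle (#|A| * k) (fun X => \prod_(i in A) h i X).
Proof.
move=> dh; rewrite cardE; apply: (@degle_ext _ (fun X => \prod_(i <- enum A) h i X)).
  by move=> X; rewrite big_enum.
elim: (enum A) => [|i r IH] /=.
  by apply: degle_ext (degle_const _ 1) => X; rewrite big_nil.
by rewrite mulSn; apply: degle_ext (degle_mul (dh i) IH) => X; rewrite big_cons.
Qed.

Lemma degle_exp d k f : degle d f -> degle (k * d) (fun X => f X ^+ k).
Proof.
move=> df; elim: k => [|k IH].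
  by apply: degle_ext (degle_const _ 1) => X; rewrite expr0.
by rewrite mulSn; apply: degle_ext (degle_mul df IH) => X; rewrite exprS.
Qed.

(** Restricting to a sample substitutes 0 for the variables outside [S], so sampling costs no
    degree. *)
Lemma degle_restrict d f S : degle d f -> degle d (fun X => f (X :&: S)).
Proof.
elim=> [{}d c|{}d i|{}d f1 g _ IHf _ IHg|{}d d' f1 g _ IHf _ IHg].
- exact: degle_const.
- case iS : (i \in S).
    by apply: degle_ext (degle_var d i) => X; rewrite inE iS andbT.
  by apply: degle_ext (degle_const _ 0) => X; rewrite inE iS andbF.
- exact: degle_add.
- exact: degle_mul.
Qed.

Lemma degle_mpoly d f : degle d f -> exists2 p : {mpoly F[n]}, (msize p <= d.+1)%N &
  forall x : n.-tuple bool,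
    p.@[fun j => (tnth x j)%:R] = f [set j | tnth x j].
Proof.
elim=> [{}d c|{}d i|{}d f1 g _ [p sp pE] _ [q sq qE]|
        {}d d' f1 g _ [p sp pE] _ [q sq qE]].
- exists c%:MP; last by move=> x; rewrite mevalC.
  by rewrite msizeC; case: (c == 0).
- exists 'X_i; last by move=> x; rewrite mevalXU inE.
  by rewrite msizeX mdeg1.
- exists (p + q); last by move=> x; rewrite mevalD pE qE.
  by apply: leq_trans (msizeD_le _ _) _; rewrite geq_max sp sq.
- exists (p * q); last by move=> x; rewrite mevalM pE qE.
  have [->|p0] := eqVneq p 0; first by rewrite mul0r msize0.
  have [->|q0] := eqVneq q 0; first by rewrite mulr0 msize0.
  by rewrite msizeM//; move: (msize p) (msize q) sp sq => a b; lia.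
Qed.

(** For [a = 0] this is the [j]-th elementary symmetric polynomial in the bits, which counts the
    [j]-subsets of the true ones. Pascal's rule then shifts [a] by one. No division occurs, so every
    characteristic is covered. *)
Lemma degle_binomial k m (b : 'I_m -> {set 'I_n} -> bool) a j :
  (forall i, degle k (fun X => (b i X)%:R)) ->
  exists2 f, degle (j * k) f & forall X, (a <= \sum_i b i X)%N ->
    f X = 'C(\sum_i b i X - a, j)%:R.
Proof.
move=> db; elim: a j => [|a IHa] j.
  exists (fun X => \sum_(h : {set 'I_m} | #|h| == j) \prod_(i in h) (b i X)%:R).
    by apply: degle_sum => h /eqP <-; exact: degle_prod.
  move=> X _; rewrite subn0; set A := [set i | b i X].
  have -> : (\sum_i b i X = #|A|)%N.
    by rewrite -sum1_card [RHS]big_mkcond/=; apply: eq_bigr => i _; rewrite inE; case: (b i X).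
  rewrite -cards_draws -sum1_card natr_sum big_mkcond/= [RHS]big_mkcond/=.
  apply: eq_bigr => h _; rewrite inE; case: (#|h| == j); rewrite ?andbF ?andbT//.
  case: ifPn => [/subsetP hA|/subsetPn[i ih]].
    by rewrite big1// => i /hA; rewrite inE => ->.
  by rewrite inE => /negbTE bi; rewrite (bigD1 i)//= bi mul0r.
elim: j => [|j [g dg gE]].
  by exists (fun=> 1); [exact: degle_const|move=> X _; rewrite bin0].
have [f df fE] := IHa j.+1.
exists (fun X => f X - g X).
  by apply: degle_sub => //; apply: degle_weak dg; rewrite leq_mul2r leqnSn orbT.
move=> X aX; rewrite fE ?(ltnW aX)// gE//.
by rewrite -(subnSK aX) binS natrD addrK.
Qed.

(** Newton interpolation: the binomial basis is triangular with ones on the diagonal, so it works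
    where Lagrange denominators could vanish. *)
Lemma binomial_interpolation (g : nat -> F) D : exists c : nat -> F,
  forall m, (m <= D)%N -> g m = \sum_(j < D.+1) c j * 'C(m, j)%:R.
Proof.
elim: D => [|D [c cE]].
  by exists g => m; rewrite leqn0 => /eqP ->; rewrite big_ord1 mulr1.
pose v := g D.+1 - \sum_(j < D.+1) c j * 'C(D.+1, j)%:R.
exists (fun j => if j == D.+1 then v else c j) => m.
have E (k : nat) : \sum_(j < D.+1) (if j == D.+1 :> nat then v else c j) * 'C(k, j)%:R
    = \sum_(j < D.+1) c j * 'C(k, j)%:R.
  by apply: eq_bigr => j _; rewrite ltn_eqF.
rewrite big_ord_recr/= eqxx E leq_eqVlt ltnS => /orP[/eqP ->|mD].
  by rewrite binn mulr1 addrC subrK.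
by rewrite bin_small// mulr0 addr0 cE.
Qed.

(** The cost depends on the width [D] of the window, not on its position [a]. Bits of degree [k] are
    allowed for the later vote over sketches. *)
Lemma degle_interpolation k m (b : 'I_m -> {set 'I_n} -> bool) (g : nat -> F) a D :
  (forall i, degle k (fun X => (b i X)%:R)) ->
  exists2 f, degle (D * k) f &
    forall X, (a <= \sum_i b i X <= a + D)%N -> f X = g (\sum_i b i X)%N.
Proof.
move=> db; have [c cE] := binomial_interpolation (fun m => g (a + m)%N) D.
have /choice[h hP] j : exists f, degle (j * k) f /\ forall X, (a <= \sum_i b i X)%N ->
    f X = 'C(\sum_i b i X - a, j)%:R.
  by have [f ? ?] := degle_binomial a j db; exists f.
exists (fun X => \sum_(j < D.+1) c j * h j X).
  apply: degle_sum => j _; apply/degle_scale/degle_weak/(hP j).1.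
  by rewrite leq_mul2r -ltnS ltn_ord orbT.
move=> X /andP[aX Xa].
rewrite -[in RHS](subnKC aX) cE ?leq_subLR//.
by apply: eq_bigr => j _; rewrite (hP j).2.
Qed.

Lemma degle_weight (g : nat -> F) a D : exists2 f, degle D f &
  forall X, (a <= #|X| <= a + D)%N -> f X = g #|X|.
Proof.
have := @degle_interpolation 1 n (fun i X => i \in X) g a D (fun i => degle_var _ i).
have E X : (\sum_i (i \in X) = #|X|)%N by rewrite -sum1_card [RHS]big_mkcond.
by rewrite muln1 => -[f df fE]; exists f => // X; rewrite -E => /fE.
Qed.

End Degree.

(** * Uniform averages over finite seed spaces and exponential moments *)

Section Average.
Variable R : realType.

Definition avg (T : finType) (f : T -> R) : R := (\sum_t f t) / #|T|%:R.

Definition prob (T : finType) (E : pred T) : R := avg (fun t => (E t)%:R).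

Lemma avg_le (T : finType) (f g : T -> R) :
  (forall t, f t <= g t) -> avg f <= avg g.
Proof. by move=> fg; apply: ler_wpM2r; rewrite ?invr_ge0// ler_sum. Qed.

Lemma eq_avg (T : finType) (f g : T -> R) : f =1 g -> avg f = avg g.
Proof. by move=> /funext ->. Qed.

Lemma avg_const (T : finType) c : (0 < #|T|)%N -> avg (fun _ : T => c) = c.
Proof.
move=> T0; rewrite /avg sumr_const -[c *+ _]mulr_natr mulfK//.
by rewrite pnatr_eq0 -lt0n.
Qed.

Lemma avgD (T : finType) (f g : T -> R) : avg (fun t => f t + g t) = avg f + avg g.
Proof. by rewrite /avg big_split mulrDl. Qed.

Lemma avgZ (T : finType) c (f : T -> R) : avg (fun t => c * f t) = c * avg f.
Proof. by rewrite /avg -mulr_sumr mulrA. Qed.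

Lemma avg_pair (S T : finType) (f : S -> T -> R) :
  avg (fun w : S * T => f w.1 w.2) = avg (fun s => avg (f s)).
Proof.
rewrite /avg card_prod natrM invfM mulrA -pair_bigA /= mulrAC; congr (_ / _).
by rewrite mulr_suml; apply: eq_bigr => s _; rewrite mulr_suml.
Qed.

Lemma avg_ffun (I : finType) (T : finType) (g : I -> T -> R) :
  avg (fun w : {ffun I -> T} => \prod_i g i (w i)) = \prod_i avg (g i).
Proof.
rewrite /avg -bigA_distr_bigA card_ffun natrX prodf_div; congr (_ / _).
by rewrite prodr_const.
Qed.

Lemma prob_le (T : finType) (E1 E2 : pred T) :
  (forall t, E1 t -> E2 t) -> prob E1 <= prob E2.
Proof.
move=> E12; apply: avg_le => t; case E1t : (E1 t); last exact: ler0n.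
by rewrite (E12 _ E1t).
Qed.

Lemma prob_le1 (T : finType) (E : pred T) : prob E <= 1.
Proof.
have [T0|T0] := posnP #|T|; first by rewrite /prob /avg T0 invr0 mulr0.
by rewrite -[leRHS](avg_const 1 T0); apply: avg_le => t; case: (E t); rewrite ?ler01.
Qed.

Lemma prob_union (T : finType) (E E1 E2 : pred T) :
  (forall t, E t -> E1 t || E2 t) -> prob E <= prob E1 + prob E2.
Proof.
move=> EU; rewrite /prob -avgD; apply: avg_le => t.
have := EU t; case: (E t) => [/(_ isT)|_]; last by rewrite addr_ge0 ?ler0n.
by case: (E1 t); case: (E2 t) => //= _; rewrite ?addr0 ?add0r// lerDl ler01.
Qed.

(** Markov's inequality in exponential form: [expR (g t)] dominates the indicator of [E]. *)
Lemma prob_chernoff (T : finType) (E : pred T) (g : T -> R) :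
  (forall t, E t -> 0 <= g t) -> prob E <= avg (fun t => expR (g t)).
Proof.
move=> Eg; apply: avg_le => t; case Et : (E t); last exact: expR_ge0.
by apply: le_trans (expR_ge1Dx _); rewrite lerDl Eg.
Qed.

(** Since [expR l <= 1 / (1 - l)], it is enough that [(1 - l) * (1 + l + 2 * l ^+ 2) = 1 + l ^+ 2 *
    (1 - 2 * l)]. *)
Lemma expR_le_quadratic (l : R) : l <= 2^-1 -> expR l <= 1 + l + 2 * l ^+ 2.
Proof.
move=> l2; have l1 : 0 < 1 - l by lra.
rewrite -[l in expR l]opprK expRN; apply: (@le_trans _ _ (1 - l)^-1).
  rewrite lef_pV2 ?posrE ?expR_gt0//; exact: (expR_ge1Dx (- l)).
rewrite -[leLHS]mul1r ler_pdivrMr//.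
have : 0 <= l ^+ 2 * (1 - 2 * l) by rewrite mulr_ge0 ?sqr_ge0//; lra.
nra.
Qed.

Lemma expRN_le_half : expR (- 1) <= 2^-1 :> R.
Proof. by rewrite expRN lef_pV2 ?posrE ?expR_gt0//; exact: expR_ge1Dx. Qed.

(** * Moments and tails of the size of a random sample *)

Section Sampling.
Variables (n q : nat).

(* Each point is retained independently with probability [1 / q.+1]. *)
Definition sample (s : {ffun 'I_n -> 'I_q.+1}) : {set 'I_n} :=
  [set i | s i == ord0].

Lemma avg_sample_pow (z : R) (X : {set 'I_n}) :
  avg (fun s => z ^+ #|X :&: sample s|) = (1 + (z - 1) / q.+1%:R) ^+ #|X|.
Proof.
pose g i (a : 'I_q.+1) := if (i \in X) && (a == ord0) then z else 1.
have -> : avg (fun s => z ^+ #|X :&: sample s|) =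
    avg (fun s : {ffun 'I_n -> 'I_q.+1} => \prod_i g i (s i)).
  apply: eq_avg => s; rewrite /g -big_mkcond/= -prodr_const.
  by apply: eq_bigl => i; rewrite !inE.
rewrite avg_ffun -prodr_const [RHS]big_mkcond/=; apply: eq_bigr => i _.
rewrite /g /avg card_ord; case: (i \in X) => /=.
  rewrite (bigD1 ord0)//= (eq_bigr (fun=> 1)); last by move=> j /negbTE ->.
  rewrite sumr_const cardC1 card_ord /= -natr1.
  have : q%:R + 1 != 0 :> R by rewrite natr1 pnatr_eq0.
  by move=> ?; field.
by rewrite sumr_const card_ord divff// pnatr_eq0.
Qed.

Lemma avg_sample_exp (l : R) (X : {set 'I_n}) : l <= 2^-1 ->
  avg (fun s => expR (l * #|X :&: sample s|%:R)) <=
    expR (#|X|%:R * (l + 2 * l ^+ 2) / q.+1%:R).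
Proof.
move=> l2; under eq_avg do rewrite expRM_natr.
rewrite avg_sample_pow -mulrA expRM_natl; apply: lerXn2r.
- rewrite nnegrE.
  have -> : 1 + (expR l - 1) / q.+1%:R = (expR l + q%:R) / q.+1%:R.
    by rewrite -natr1; have : q%:R + 1 != 0 :> R by [rewrite natr1 pnatr_eq0]; move=> ?; field.
  by rewrite divr_ge0 ?addr_ge0 ?expR_ge0.
- by rewrite nnegrE expR_ge0.
apply: le_trans (expR_ge1Dx _); rewrite lerD2l ler_wpM2r ?invr_ge0//.
by have := expR_le_quadratic l2; lra.
Qed.

(** Positive [l] gives upper tails, negative [l] lower tails. *)
Lemma prob_sample_chernoff (l c : R) (X : {set 'I_n})
    (E : pred {ffun 'I_n -> 'I_q.+1}) : l <= 2^-1 ->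
  (forall s, E s -> 0 <= l * #|X :&: sample s|%:R + c) ->
  prob E <= expR (#|X|%:R * (l + 2 * l ^+ 2) / q.+1%:R + c).
Proof.
move=> l2 Eg; apply: le_trans (prob_chernoff Eg) _.
under eq_avg do rewrite expRD mulrC.
by rewrite avgZ mulrC expRD ler_wpM2r ?expR_ge0 ?avg_sample_exp.
Qed.

End Sampling.
End Average.

(** * Simultaneous approximation of thresholds and recursion over samples *)

Section Approximation.
Variables (R : realType) (F : fieldType) (n : nat).
Implicit Types (X : {set 'I_n}) (Q : nat -> {set 'I_n} -> F).

Definition wrong t Q X : bool :=
  ~~ [forall i : 'I_t.+1, Q i X == (i <= #|X|)%N%:R].

Lemma rightP t Q X :
  reflect (forall i, (i <= t)%N -> Q i X = (i <= #|X|)%N%:R) (~~ wrong t Q X).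
Proof.
rewrite negbK; apply: (iffP forallP) => [H i it|H i]; last by rewrite H// -ltnS.
by have /eqP := H (Ordinal (it : (i < t.+1)%N)).
Qed.

(* All thresholds up to [t] are computed at once, and the error bound may
   depend on the input: the recursion over sampling levels needs both. *)
Definition approx (t : nat) (e : {set 'I_n} -> R) (d : nat) : Prop :=
  exists (T : finType) (P : T -> nat -> {set 'I_n} -> F),
    [/\ (0 < #|T|)%N, forall w i, (i <= t)%N -> degle d (P w i) &
        forall X, prob R (fun w => wrong t (P w) X) <= e X].

Lemma approx_mono t t' e e' d d' : (t <= t')%N -> (d' <= d)%N ->
  (forall X, e' X <= e X) -> approx t' e' d' -> approx t e d.
Proof.
move=> tt' dd' ee' [T [P [T0 dP eP]]]; exists T, P; split=> // [w i it|X].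
  by apply: degle_weak dd' (dP _ _ _); exact: leq_trans tt'.
apply: le_trans (ee' X); apply: le_trans (eP X); apply: prob_le => w.
by apply: contraLR => /rightP H; apply/rightP => i it; rewrite H// (leq_trans it).
Qed.

(** The new seed pairs a sample with an inner seed. An error requires a bad sample or an inner error
    at the sampled set, and the latter is averaged over samples. Both recursions go through this
    step. *)
Lemma approx_sample q t t' d d' (e' err : {set 'I_n} -> R)
    (Phi : nat -> {set 'I_n} -> (nat -> F) -> F)
    (bad : {set 'I_n} -> pred {ffun 'I_n -> 'I_q.+1}) :
  (forall i h, (i <= t)%N -> (forall j, (j <= t')%N -> degle d' (h j)) ->
    degle d (fun X => Phi i X (fun j => h j X))) ->
  (forall X s y, ~~ bad X s ->
    (forall j, (j <= t')%N -> y j = (j <= #|X :&: sample s|)%N%:R) ->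
    forall i, (i <= t)%N -> Phi i X y = (i <= #|X|)%N%:R) ->
  (forall X, prob R (bad X) <= err X) ->
  approx t' e' d' ->
  approx t (fun X => err X + avg (fun s : {ffun 'I_n -> 'I_q.+1} =>
    e' (X :&: sample s))) d.
Proof.
move=> degPhi Phi_right badP [T [P [T0 dP eP]]].
pose S : finType := {ffun 'I_n -> 'I_q.+1}.
have S0 : (0 < #|S|)%N by rewrite card_ffun !card_ord expn_gt0.
pose ST : finType := (S * T)%type.
exists ST, (fun (w : ST) i X => Phi i X (fun j => P w.2 j (X :&: sample w.1))).
split=> [|w i it|X]; first by rewrite card_prod muln_gt0 S0 T0.
  by apply: (degPhi i) => // j jt; apply/degle_restrict/dP.
apply: (@le_trans _ _ (prob R (fun w : S * T => bad X w.1) +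
   prob R (fun w : S * T => wrong t' (P w.2) (X :&: sample w.1)))).
  apply: prob_union => w; apply: contraLR; rewrite negb_or => /andP[gX /rightP rX].
  by apply/rightP => i it; exact: Phi_right rX _ it.
apply: lerD; last first.
  rewrite /prob (avg_pair (fun s w => (wrong t' (P w) (X :&: sample s))%:R)).
  by apply: avg_le => s; exact: eP.
rewrite /prob (avg_pair (fun s _ => (bad X s)%:R)); apply: le_trans (badP X).
by apply: avg_le => s; rewrite avg_const.
Qed.

Lemma expRN_le_quarter (y : R) : 2 <= y -> expR (- y) <= 4^-1.
Proof.
move=> y2; apply: (@le_trans _ _ (expR (- 1 + - 1))); first by rewrite ler_expR; lra.
rewrite expRD; have := expRN_le_half R; have := expR_ge0 (- 1 : R); nra.
Qed.

(** The error budget of one level: half goes to bad samples, and [expR (- 1) <= 1 / 2] makes room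
    for the recursive call at [l.+1]. *)
Lemma expRN_step (l : nat) : (0 < l)%N ->
  expR (- l%:R) / 2 + expR (- l.+1%:R) <= expR (- l%:R) :> R.
Proof.
move=> l0; rewrite -[l.+1%:R]natr1 opprD expRD.
have := expRN_le_half R; have := expR_ge0 (- l%:R : R); nra.
Qed.

(* The sample has expected size [#|X| / 32]; the tolerated deviation is [4 l r],
   scaled by 32 to stay in [nat]. *)
Definition bad_sample l r X (s : {ffun 'I_n -> 'I_31.+1}) : bool :=
  let w := #|X :&: sample s| in
  if (#|X| <= 2 * (l * r ^ 2))%N
  then (#|X| + 128 * (l * r) <= 32 * w)%N || (32 * w + 128 * (l * r) <= #|X|)%N
  else (32 * w <= l * r ^ 2 + 128 * (l * r))%N.

(** Chernoff with parameter [1 / r] up to sign; each tail is at most [expR (- 3 l)]. For small [X]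
    the quadratic term contributes at most [l / 8] against a gain of [4 l] from the deviation. For
    large [X] the gap between mean and cutoff gains [l r / 32 >= 8 l], by [r >= 256], against losses
    of [4 l + l / 8]. *)
Lemma prob_bad_sample l r X : (0 < l)%N -> (256 <= r)%N ->
  prob R (bad_sample l r X) <= expR (- l%:R) / 2.
Proof.
move=> l0 r256; have l1 : 1 <= l%:R :> R by rewrite ler1n.
have rR : 256 <= r%:R :> R by rewrite (ler_nat R 256).
have r0 : r%:R != 0 :> R by apply/eqP; lra.
set p := r%:R^-1 : R.
have p0 : 0 < p by rewrite invr_gt0; lra.
have pr : p * r%:R = 1 by rewrite mulVf.
have p2 : p <= 2^-1 by rewrite lef_pV2 ?posrE//; lra.
have e3 : expR (- (3 * l%:R)) <= expR (- l%:R) / 4 :> R.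
  have -> : - (3 * l%:R) = - l%:R + - (2 * l%:R) :> R by ring.
  by rewrite expRD ler_wpM2l ?expR_ge0// expRN_le_quarter//; lra.
have el0 := expR_ge0 (- l%:R : R).
rewrite /bad_sample; case: leqP => Xt.
  have wt : #|X|%:R * p ^+ 2 <= 2 * l%:R.
    move: Xt; rewrite -(ler_nat R) !natrM => Xt.
    have -> : 2 * l%:R = 2%:R * (l%:R * (r%:R * r%:R)) * p ^+ 2 :> R.
      by transitivity (2 * l%:R * (p * r%:R) ^+ 2); [rewrite pr expr1n mulr1|ring].
    by rewrite ler_wpM2r// sqr_ge0.
  have -> : expR (- l%:R) / 2 = expR (- l%:R) / 4 + expR (- l%:R) / 4 :> R by field.
  apply: le_trans (@prob_union R _ _
    (fun s => (#|X| + 128 * (l * r) <= 32 * #|X :&: sample s|)%N)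
    (fun s => (32 * #|X :&: sample s| + 128 * (l * r) <= #|X|)%N) (fun s => id)) _.
  apply: lerD; apply: le_trans e3.
    have c : forall s : {ffun 'I_n -> 'I_31.+1},
        (#|X| + 128 * (l * r) <= 32 * #|X :&: sample s|)%N ->
        0 <= p * #|X :&: sample s|%:R + - (p * #|X|%:R / 32 + 4 * l%:R).
      move=> s; rewrite -(ler_nat R) natrD !natrM => H.
      have : p * (#|X|%:R + 128%:R * (l%:R * r%:R)) <= p * (32%:R * #|X :&: sample s|%:R).
        by rewrite ler_wpM2l// ltW.
      have -> : p * (#|X|%:R + 128%:R * (l%:R * r%:R)) =
          p * #|X|%:R + 128 * l%:R * (p * r%:R) :> R by ring.
      by rewrite pr; lra.
    apply: le_trans (prob_sample_chernoff p2 c) _.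
    by rewrite ler_expR; lra.
  have c : forall s : {ffun 'I_n -> 'I_31.+1},
      (32 * #|X :&: sample s| + 128 * (l * r) <= #|X|)%N ->
      0 <= (- p) * #|X :&: sample s|%:R + (p * #|X|%:R / 32 - 4 * l%:R).
    move=> s; rewrite -(ler_nat R) natrD !natrM => H.
    have : p * (32%:R * #|X :&: sample s|%:R + 128%:R * (l%:R * r%:R)) <= p * #|X|%:R.
      by rewrite ler_wpM2l// ltW.
    have -> : p * (32%:R * #|X :&: sample s|%:R + 128%:R * (l%:R * r%:R)) =
        32 * (p * #|X :&: sample s|%:R) + 128 * l%:R * (p * r%:R) :> R by ring.
    by rewrite pr; lra.
  have pN : - p <= 2^-1 by lra.
  apply: le_trans (prob_sample_chernoff pN c) _.
  by rewrite ler_expR sqrrN; lra.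
have c : forall s : {ffun 'I_n -> 'I_31.+1},
    (32 * #|X :&: sample s| <= l * r ^ 2 + 128 * (l * r))%N ->
    0 <= (- p) * #|X :&: sample s|%:R + (l%:R * r%:R / 32 + 4 * l%:R).
  move=> s; rewrite -(ler_nat R) natrD !natrM => H.
  have : p * (32%:R * #|X :&: sample s|%:R) <=
      p * (l%:R * (r%:R * r%:R) + 128%:R * (l%:R * r%:R)).
    by rewrite ler_wpM2l// ltW.
  have -> : p * (l%:R * (r%:R * r%:R) + 128%:R * (l%:R * r%:R)) =
      l%:R * r%:R * (p * r%:R) + 128 * l%:R * (p * r%:R) :> R by ring.
  by rewrite pr; lra.
have pN : - p <= 2^-1 by lra.
apply: le_trans (prob_sample_chernoff pN c) _.
apply: (@le_trans _ _ (expR (- (3 * l%:R)))); last by lra.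
rewrite ler_expR sqrrN.
have : (p - 2 * p ^+ 2) * #|X|%:R >= (p - 2 * p ^+ 2) * (2 * (l%:R * r%:R ^+ 2)).
  apply: ler_wpM2l; first by nra.
  by rewrite -natrX -!natrM ler_nat ltnW.
have -> : (p - 2 * p ^+ 2) * (2 * (l%:R * r%:R ^+ 2)) =
    2 * l%:R * r%:R * (p * r%:R) - 4 * l%:R * (p * r%:R) ^+ 2 :> R by ring.
rewrite pr expr1n; have : l%:R * 256 <= l%:R * r%:R :> R by rewrite ler_wpM2l// ler0n.
by lra.
Qed.

(* With [u] and [v] the thresholds of the sample slightly below and slightly
   above [i / 32], the [i]-th threshold is [v + (u - v) A]: unless the sample
   already decides it, the weight lies in a window of width [O(l r)], on which
   the polynomial [A] interpolates. *)
Lemma approx_step l r d : (0 < l)%N -> (256 <= r)%N ->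
  approx (l.+1 * (r %/ 4) ^ 2) (fun=> expR (- l.+1%:R)) d ->
  approx (l * r ^ 2) (fun=> expR (- l%:R)) (d + 544 * (l * r)).
Proof.
move=> l0 r256 H.
pose D := (4 * (l * r))%N.
(* For an undecided threshold, a good sample places the weight between [i - 32 - 64 D] and
   [i + 64 D]; this window has width [128 D + 32 <= 544 l r]. *)
have /choice[A AP] i : exists f : {set 'I_n} -> F, degle (544 * (l * r)) f /\
    forall X, (i - (32 + 64 * D) <= #|X| <= i - (32 + 64 * D) + 544 * (l * r))%N ->
      f X = (i <= #|X|)%N%:R.
  have [f df fE] := degle_weight n (fun k => (i <= k)%N%:R : F) (i - (32 + 64 * D)) (544 * (l * r)).
  by exists f.
pose lo i := (i %/ 32 - D)%N; pose hi i := (i %/ 32 + D + 1)%N.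
(* The main term [l r ^ 2 / 32] is only half of [l (r / 4) ^ 2]; since [r / 4 >= 64], the other half
   absorbs the deviation and the rounding. *)
have hit i : (i <= l * r ^ 2)%N -> (hi i <= l.+1 * (r %/ 4) ^ 2)%N.
  rewrite /hi /D => it; set k := (r %/ 4)%N.
  have rk : (r <= 4 * k + 3)%N by rewrite /k; lia.
  have k64 : (64 <= k)%N by rewrite /k; lia.
  have : (r ^ 2 <= (4 * k + 3) ^ 2)%N by rewrite leq_sqr.
  have : (i %/ 32 * 32 <= i)%N by exact: leq_trunc_div.
  nia.
have loh i : (lo i <= hi i)%N by rewrite /lo /hi; lia.
pose Phi i X (y : nat -> F) := y (hi i) + (y (lo i) - y (hi i)) * A i X.
apply: approx_mono (leqnn _) (leqnn _) _ (@approx_sample 31 (l * r ^ 2) _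
  (d + 544 * (l * r)) d _ (fun=> expR (- l%:R) / 2) Phi (bad_sample l r) _ _ _ H).
- move=> X; rewrite avg_const; last by rewrite card_ffun !card_ord expn_gt0.
  exact: expRN_step.
- move=> i h it dh; rewrite /Phi.
  apply: degle_add; first by apply: degle_weak (dh _ (hit _ it)); exact: leq_addr.
  apply: degle_mul (AP i).1; apply: degle_sub; apply: dh; last exact: hit.
  exact: leq_trans (hit _ it).
- move=> X s y gX yE i it; rewrite /Phi !yE ?hit//; last exact: leq_trans (hit _ it).
  move: gX; rewrite /bad_sample.
  set w := #|X :&: sample s|; set x := #|X| => gX.
  (* Passing only the upper threshold is impossible; in the three remaining cases the sample says
     yes, leaves the answer to [A], or says no. *)
  have hiw : (lo i <= w)%N || ~~ (hi i <= w)%N.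
    by have := loh i; case: leqP => //; lia.
  move: hiw.
  case low: (lo i <= w)%N; case hw: (hi i <= w)%N => //= _.
  + rewrite subrr mul0r addr0; congr (_%:R); move: gX hw; rewrite /hi /D.
    by case: ifP; lia.
  + rewrite add0r subr0 mul1r; apply: (AP i).2.
    move: gX low hw; rewrite -/x /lo /hi /D.
    by case: ifP; lia.
  + rewrite subrr mul0r addr0; congr (_%:R); move: gX low; rewrite /lo /D.
    by case: ifP; lia.
- by move=> X; exact: prob_bad_sample.
Qed.

(** Strong induction on [r]; below 256 the base case applies because [r ^ 2 <= K]. Otherwise
    [l.+1 * (r %/ 4) <= l * r / 2], so the recursive call uses half of the degree bound and the
    window [544 l r] fits in the other half, whence [1088 = 2 * 544]. *)
Lemma approx_amplify B K : (0 < B)%N -> (256 ^ 2 <= K)%N ->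
  (forall l, (0 < l)%N -> approx (l * K) (fun=> expR (- l%:R)) (B * l)) ->
  forall r l, (0 < l)%N -> (0 < r)%N ->
    approx (l * r ^ 2) (fun=> expR (- l%:R)) (1088 * B * (l * r)).
Proof.
move=> B0 K256 base r; have [k] := ubnP r; elim: k r => // k IH r rk l l0 r0.
have [r256|r256] := ltnP r 256.
  apply: approx_mono (base l l0) => //.
    by rewrite leq_mul2l (leq_trans _ K256) ?orbT// leq_sqr ltnW.
  by rewrite mulnCA mulnC; nia.
have Hs := IH (r %/ 4)%N _ l.+1 _ _.
apply: approx_mono (leqnn _) _ _ (approx_step l0 r256 (Hs _ _ _)); [|by []|lia|lia|lia].
have h1 : (l.+1 * (r %/ 4) * 2 <= l * r)%N.
  have : (l.+1 * (r %/ 4 * 4) <= (2 * l) * r)%N by apply: leq_mul; lia.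
  by lia.
have h2 : (l * r <= B * (l * r))%N by exact: leq_pmull.
have : (B * (l.+1 * (r %/ 4) * 2) <= B * (l * r))%N by rewrite leq_mul2l h1 orbT.
by lia.
Qed.

End Approximation.

(** * The base case over an arbitrary field *)

Section AnyCharacteristic.
Variables (R : realType) (F : fieldType) (n : nat).
Implicit Types (X : {set 'I_n}).

Lemma threshold_interpolation M : exists A : nat -> {set 'I_n} -> F,
  forall i, degle M (A i) /\ forall X, (#|X| <= M)%N -> A i X = (i <= #|X|)%N%:R.
Proof.
have /choice[A AP] i : exists f : {set 'I_n} -> F,
    degle M f /\ forall X, (#|X| <= M)%N -> f X = (i <= #|X|)%N%:R.
  by have [f df fE] := degle_weight n (fun k => (i <= k)%N%:R : F) 0 M; exists f.
by exists A.
Qed.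

(* Among the nested samples of a set of more than [128 t] points, the first
   one with at most [128 t] points still has at least [t] of them, and this is
   detected exactly by a polynomial of degree [128 t]; multiplying over the
   levels adds up the degrees. *)
Lemma approx_levels t J :
  @approx R F n t (fun X => J%:R * expR (- (t%:R / 4)) +
    (1 + 32%:R ^- J) ^+ #|X| * 2^-1 ^+ (128 * t)) (J.+1 * (128 * t)).
Proof.
have [A AP] := threshold_interpolation (128 * t).
elim: J => [|J IH].
  exists unit, (fun=> A); split=> [|_ i _|X]; first by rewrite card_unit.
    by rewrite mul1n; exact: (AP i).1.
  rewrite mul0r add0r expr0 invr1.
  (* At level 0, [A] is exact up to [128 t] points; beyond, the claimed bound is at least 1. *)
  have [Xt|/ltnW Xt] := leqP #|X| (128 * t).
    apply: (@le_trans _ _ 0); last by rewrite mulr_ge0 ?exprn_ge0 ?addr_ge0 ?invr_ge0.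
    rewrite -[leRHS](@avg_const R unit 0) ?card_unit//; apply: avg_le => -[].
    by rewrite (_ : wrong _ _ _ = false)//; apply/negbTE/rightP => i _; exact: (AP i).2.
  apply: le_trans (prob_le1 _ _) _.
  have -> : 1 + 1 = 2 :> R by ring.
  by rewrite exprVn ler_pdivlMr ?exprn_gt0// mul1r ler_eXn2l// ltr1n.
pose bad X (s : {ffun 'I_n -> 'I_31.+1}) :=
  (128 * t < #|X|)%N && (#|X :&: sample s| < t)%N.
(* The disjunction of [A i] and the verdict that the sample has at least [t] points. For small [X]
   the latter is harmless: it implies [i <= t <= #|X|]. *)
pose Phi i X (y : nat -> F) := 1 - (1 - A i X) * (1 - y t).
apply: approx_mono (leqnn _) (leqnn _) _ (@approx_sample _ _ _ 31 t t
  (J.+2 * (128 * t)) _ _ (fun=> expR (- (t%:R / 4))) Phi bad _ _ _ IH).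
- move=> X; rewrite avgD avg_const; last by rewrite card_ffun !card_ord expn_gt0.
  (* Averaging turns the base [1 + 32 ^- J] into [1 + 32 ^- J.+1], so the second error term keeps
     its form. *)
  rewrite [X in _ + (_ + X)](_ : _ = (1 + 32%:R ^- J.+1) ^+ #|X| * 2^-1 ^+ (128 * t)).
    by rewrite addrA -[J.+1%:R]natr1 mulrDl mul1r [expR _ + _]addrC.
  under eq_avg do rewrite mulrC.
  rewrite avgZ avg_sample_pow mulrC; congr (_ ^+ _ * _).
  by rewrite [1 + _ - 1]addrAC subrr add0r -invfM -exprSr.
- move=> i h it dh; rewrite /Phi [(J.+2 * _)%N]mulSn.
  apply: degle_sub; first exact: degle_const.
  by apply: degle_mul; apply: degle_sub;
    [exact: degle_const|exact: (AP i).1|exact: degle_const|exact: dh].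
- move=> X s y gX yE i it; rewrite /Phi yE//.
  have Xs : (#|X :&: sample s| <= #|X|)%N by rewrite subset_leq_card// subsetIl.
  have [Xt|Xt] := leqP #|X| (128 * t).
    rewrite (AP i).2//; case: (leqP i #|X|) => [iX|Xi]; first by rewrite subrr mul0r subr0.
    rewrite leqNgt (leq_ltn_trans Xs) ?(leq_trans Xi)//.
    by rewrite subr0 mulr1 subrr.
  have tX : (t <= #|X :&: sample s|)%N by move: gX; rewrite /bad Xt -leqNgt.
  by rewrite tX subrr mulr0 subr0 (leq_trans it)// (leq_trans tX).
move=> X; rewrite /bad; have [Xt|Xt] := leqP #|X| (128 * t).
  rewrite -[leRHS]addr0; apply: (@le_trans _ _ 0); last by rewrite addr0 expR_ge0.
  rewrite -[leRHS](@avg_const R {ffun 'I_n -> 'I_31.+1} 0); last first.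
    by rewrite card_ffun !card_ord expn_gt0.
  exact: avg_le.
have l2 : - 4^-1 <= 2^-1 :> R by lra.
have c (s : {ffun 'I_n -> 'I_31.+1}) : (#|X :&: sample s| < t)%N ->
    0 <= - 4^-1 * #|X :&: sample s|%:R + t%:R / 4 :> R.
  by move=> /ltnW; rewrite -(ler_nat R); lra.
apply: le_trans (prob_sample_chernoff l2 c) _.
by move: Xt; rewrite ler_expR -(ltr_nat R) natrM; lra.
Qed.

Lemma expR_half_le2 : expR (2^-1) <= 2 :> R.
Proof. by apply: le_trans (expR_le_quadratic (lexx _)) _; lra. Qed.

Lemma approx_base_any K l : (0 < l)%N -> (0 < K)%N ->
  @approx R F n (l * K) (fun=> expR (- l%:R))
    (512 * (K + 1) * (up_log 2 n).+1 ^ 2 * l).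
Proof.
move=> l0 K0; set J := up_log 2 n.
have nJ : (n <= 2 ^ J)%N by exact: up_logP.
(* The summand [J + 1] absorbs the factor [J] of the first error term and leaves a factor 1/2. In
   the second term [n <= 2 ^ J] bounds the power of [1 + 32 ^- J] by [expR 1]. *)
apply: approx_mono (approx_levels (4 * (l * K + J + 1)) J).
- by lia.
- have : (l * K + J + 1 <= (K + 1) * J.+1 * l)%N by nia.
  move=> H; apply: (@leq_trans (J.+1 * (128 * (4 * ((K + 1) * J.+1 * l))))).
    by rewrite !leq_mul2l H !orbT.
  by lia.
move=> X.
have lK : l%:R <= (l * K)%:R :> R by rewrite ler_nat leq_pmulr.
have J0 : 0 <= J%:R :> R by rewrite ler0n.
have lR0 : 0 <= l%:R :> R by rewrite ler0n.
have half y : l%:R + 1 <= y -> expR (- y) <= expR (- l%:R) / 2 :> R.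
  move=> ly; apply: (@le_trans _ _ (expR (- l%:R + - 1))); first by rewrite ler_expR; lra.
  by rewrite expRD ler_wpM2l ?expR_ge0// expRN_le_half.
rewrite [leRHS](_ : _ = expR (- l%:R) / 2 + expR (- l%:R) / 2); last by field.
apply: lerD.
  apply: (@le_trans _ _ (expR J%:R * expR (- ((4 * (l * K + J + 1))%:R / 4)))).
    rewrite ler_wpM2r ?expR_ge0//; apply: le_trans (expR_ge1Dx _).
    by rewrite lerDr ler01.
  rewrite -expRD -[J%:R + _]opprK; apply: half.
  by rewrite natrM !natrD; lra.
apply: (@le_trans _ _ (expR 1 * expR (- 2^-1 * (128 * (4 * (l * K + J + 1)))%:R))).
  apply: ler_pM; rewrite ?exprn_ge0// ?addr_ge0 ?invr_ge0 ?exprn_ge0//.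
  - apply: (@le_trans _ _ (expR (32%:R ^- J) ^+ #|X|)).
      apply: lerXn2r; rewrite ?nnegrE ?expR_ge0 ?expR_ge1Dx//.
      by rewrite addr_ge0 ?invr_ge0 ?exprn_ge0.
    rewrite -expRM_natl ler_expR ler_pdivrMr ?exprn_gt0// mul1r.
    rewrite -natrX ler_nat (leq_trans (max_card _))// card_ord (leq_trans nJ)//.
    by case: (J) => // j; rewrite leq_exp2r.
  rewrite expRM_natr; apply: lerXn2r; rewrite ?nnegrE ?expR_ge0 ?invr_ge0//.
  by rewrite expRN lef_pV2 ?posrE ?expR_gt0// expR_half_le2.
rewrite -expRD -[1 + _]opprK; apply: half.
by rewrite natrM natrM !natrD; lra.
Qed.

End AnyCharacteristic.

(** * The base case in characteristic [p], by voting over random sketches *)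

Section PositiveCharacteristic.
Variables (R : realType) (n p : nat).
Hypothesis p_prime : prime p.
Implicit Types (X : {set 'I_n}).

(* Toggling the membership in [U] of a point of [A] changes [#|A :&: U|] by one. *)
Lemma prob_dvdn_card A : A != set0 ->
  prob R (fun U : {set 'I_n} => (p %| #|A :&: U|)%N) <= 2^-1.
Proof.
case/set0Pn => i iA; pose E U := (p %| #|A :&: U|)%N.
pose f (U : {set 'I_n}) := if i \in U then U :\ i else i |: U.
have fE U : (A :&: f U) :\ i = (A :&: U) :\ i.
  by apply/setP => j; rewrite /f; case: ifP; rewrite !inE; case: eqP => //= ->.
have fi U : (i \in f U) = (i \notin U).
  by rewrite /f; case: ifP; rewrite !inE eqxx.
have fK : involutive f.
  move=> U; rewrite {1}/f fi; case: (boolP (i \in U)) => iU /=.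
    by rewrite /f iU setD1K.
  by rewrite /f (negbTE iU) setU1K.
have nE U : E U -> ~~ E (f U).
  rewrite /E (cardsD1 i (A :&: U)) (cardsD1 i (A :&: f U)) fE !inE iA fi /=.
  set k := #|_|; have pk : ~~ ((p %| k) && (p %| 1 + k))%N.
    apply/negP => /andP[pk]; rewrite dvdn_addl// dvdn1 => /eqP p1.
    by move: p_prime; rewrite p1.
  by move: pk; rewrite negb_and; case: (i \in U); case: (p %| k)%N; case: (p %| 1 + k)%N.
have : prob R E + prob R (fun U => E (f U)) <= 1.
  rewrite -avgD -[leRHS](@avg_const R {set 'I_n} 1); last first.
    by apply/card_gt0P; exists set0.
  apply: avg_le => U; have := nE U; case: (E U) => [/(_ isT)/negbTE ->|_].
    by rewrite addr0.
  by rewrite add0r lern1 leq_b1.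
have -> : prob R (fun U => E (f U)) = prob R E.
  by rewrite /prob /avg [in RHS](reindex_inj (inv_inj fK)).
by rewrite -/(prob R E) => H; rewrite -/E; lra.
Qed.

(** The sample makes the linear form sparse; the uniform subset makes its value nonzero modulo [p]
    with probability at least 1/2 once the sample meets the input. *)
Definition sketch_space q : finType := ({ffun 'I_n -> 'I_q.+1} * {set 'I_n})%type.

(* By Fermat this bit is the [p.-1]-st power of a linear form over a field of
   characteristic [p]. *)
Definition sketch q (w : sketch_space q) X : bool :=
  ~~ (p %| #|X :&: sample w.1 :&: w.2|)%N.

Lemma sketch_space_gt0 q : (0 < #|sketch_space q|)%N.
Proof.
rewrite card_prod muln_gt0 card_ffun !card_ord expn_gt0 /=.
by apply/card_gt0P; exists set0.
Qed.

Lemma degle_sketch (F : fieldType) q (w : sketch_space q) : p \in [pchar F] ->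
  degle p.-1 (fun X => (sketch w X)%:R : F).
Proof.
move=> charF; rewrite /sketch; set S := sample w.1.
have dS : degle 1 (fun X => \sum_(i in S :&: w.2) (i \in X)%:R : F).
  by apply: degle_sum => i _; exact: degle_var.
apply: degle_ext (degle_weak _ (degle_exp p.-1 dS)); last by rewrite muln1.
move=> X; set k := #|_|.
have -> : \sum_(i in S :&: w.2) (i \in X)%:R = k%:R :> F.
  rewrite -natr_sum; congr (_%:R); rewrite /k -sum1_card big_mkcond [RHS]big_mkcond/=.
  by apply: eq_bigr => i _; rewrite !inE; case: (i \in X); case: ifP.
rewrite (dvdn_pcharf charF); have [->|k0] := eqVneq (k%:R : F) 0.
  by rewrite expr0n -subn1 subn_eq0 leqNgt prime_gt1.
apply: (mulfI k0); rewrite -exprS prednK ?prime_gt0// mulr1.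
by have := pFrobenius_aut_nat charF k; rewrite pFrobenius_autE.
Qed.

(** The bit is at most the size of the sampled part of [X]; the parameter [l = 1 / 2] gives
    [l + 2 * l ^+ 2 = 1]. *)
Lemma avg_sketch_small q X :
  avg (fun w : sketch_space q => expR (2^-1 * (sketch w X)%:R)) <=
    expR (#|X|%:R / q.+1%:R) :> R.
Proof.
apply: (@le_trans _ _ (avg (fun w : sketch_space q =>
    expR (2^-1 * #|X :&: sample w.1|%:R)))).
  apply: avg_le => w; rewrite ler_expR ler_wpM2l ?invr_ge0// ler_nat /sketch.
  have [/cards0_eq Xs|k0] := posnP #|X :&: sample w.1|; last first.
    by apply: leq_trans (leq_b1 _) _.
  by rewrite Xs set0I cards0 dvdn0.
rewrite (avg_pair (fun s (_ : {set 'I_n}) => expR (2^-1 * #|X :&: sample s|%:R))).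
apply: (@le_trans _ _ (avg (fun s : {ffun 'I_n -> 'I_q.+1} =>
    expR (2^-1 * #|X :&: sample s|%:R)))).
  by apply: avg_le => s; rewrite avg_const//; apply/card_gt0P; exists set0.
apply: le_trans (avg_sample_exp q X (lexx _)) _; rewrite ler_expR.
by rewrite (_ : 2^-1 + _ = 1) ?mulr1//; field.
Qed.

(** The bit vanishes with probability at most [1 / 2 + 1 / 8], the last term bounding the chance
    [expR (- 3)] that the sample misses [X]. Hence the average is at most
    [7 / 8 + 5 / 64 = 1 - 3 / 64]. *)
Lemma avg_sketch_large q X : (3 * q.+1 <= #|X|)%N ->
  avg (fun w : sketch_space q => expR (- 4^-1 * (sketch w X)%:R)) <=
    expR (- (3 / 64)) :> R.
Proof.
move=> Xq.
pose z (w : sketch_space q) : R := (~~ sketch w X)%:R.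
have e4 : expR (- 4^-1) <= 7 / 8 :> R.
  by apply: le_trans (expR_le_quadratic _) _; lra.
apply: (@le_trans _ _ (avg (fun w => 7 / 8 + 8^-1 * z w))).
  apply: avg_le => w; rewrite /z; case: (sketch w X) => /=.
    by rewrite mulr1 mulr0 addr0.
  by rewrite mulr0 expR0; lra.
rewrite avgD avg_const ?sketch_space_gt0// avgZ.
have : avg z <= 2^-1 + 8^-1.
  rewrite /z /sketch.
  rewrite (avg_pair (fun s (U : {set 'I_n}) =>
    (~~ ~~ (p %| #|X :&: sample s :&: U|)%N)%:R)).
  (* As [0 ^+ 0 = 1], the power of 0 is the indicator of a sample missing [X], so [avg_sample_pow]
     applies with [z = 0]. *)
  apply: (@le_trans _ _ (avg (fun s : {ffun 'I_n -> 'I_q.+1} =>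
      2^-1 + 0 ^+ #|X :&: sample s|))).
    apply: avg_le => s; have [Xs|Xs] := eqVneq (X :&: sample s) set0.
      rewrite Xs cards0 expr0; apply: (@le_trans _ _ 1); last by lra.
      exact: prob_le1.
    rewrite expr0n cards_eq0 (negbTE Xs) addr0.
    apply: le_trans (prob_dvdn_card Xs); apply: prob_le => U; by rewrite negbK.
  rewrite avgD avg_const; last by rewrite card_ffun !card_ord expn_gt0.
  rewrite lerD2l avg_sample_pow sub0r mulN1r.
  apply: (@le_trans _ _ (expR (- q.+1%:R^-1) ^+ #|X|)).
    apply: lerXn2r; rewrite ?nnegrE ?expR_ge0 ?expR_ge1Dx//.
    by rewrite subr_ge0 invf_le1 ?ler1n// ltr0n.
  rewrite -expRM_natl; apply: (@le_trans _ _ (expR (- 1 + (- 1 + - 1)))).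
    rewrite ler_expR mulrN (_ : - 1 + _ = - 3); last by ring.
    by rewrite lerN2 ler_pdivlMr ?ltr0n// -natrM ler_nat.
  rewrite !expRD; have := expRN_le_half R; have := expR_ge0 (- 1 : R).
  move: (expR (- 1)) => a a0 a2; have : a * a <= 2^-1 * 2^-1 by apply: ler_pM.
  move=> aa; apply: (@le_trans _ _ (2^-1 * (2^-1 * 2^-1))); last by lra.
  by apply: ler_pM => //; apply: mulr_ge0.
move=> zle; have := expR_ge1Dx (- (3 / 64) : R); lra.
Qed.

Definition sketch_count q L (w : {ffun 'I_L -> sketch_space q}) X : nat :=
  \sum_r sketch (w r) X.

Lemma avg_sketch_count q L (c : R) X :
  avg (fun w : {ffun 'I_L -> sketch_space q} => expR (c * (sketch_count w X)%:R)) =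
    avg (fun w : sketch_space q => expR (c * (sketch w X)%:R)) ^+ L.
Proof.
rewrite -[L in RHS]card_ord -prodr_const -avg_ffun; apply: eq_avg => w.
by rewrite /sketch_count natr_sum mulr_sumr expR_sum.
Qed.

(** The exponent is [64 l / 32 - 4 l = - 2 l]. *)
Lemma prob_sketch_small q l X : (32 * #|X| <= q.+1)%N ->
  prob R (fun w : {ffun 'I_(64 * l) -> sketch_space q} => 8 * l <= sketch_count w X)%N
    <= expR (- l%:R).
Proof.
move=> Xq; apply: le_trans (@prob_chernoff R _ _
  (fun w => 2^-1 * (sketch_count w X)%:R + - (4 * l%:R)) _) _.
  by move=> w; rewrite -(ler_nat R) natrM; lra.
under eq_avg do rewrite expRD mulrC.
rewrite avgZ avg_sketch_count.
apply: (@le_trans _ _ (expR (- (4 * l%:R)) * expR (32^-1) ^+ (64 * l))).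
  rewrite ler_wpM2l ?expR_ge0//; apply: lerXn2r.
  - by rewrite nnegrE mulr_ge0 ?invr_ge0// sumr_ge0// => w _; exact: expR_ge0.
  - by rewrite nnegrE expR_ge0.
  apply: le_trans (avg_sketch_small _ _) _.
  by move: Xq; rewrite ler_expR ler_pdivrMr ?ltr0n// -(ler_nat R) natrM; lra.
rewrite -expRM_natl -expRD ler_expR natrM.
by have : 0 <= l%:R :> R by []; lra.
Qed.

(** The exponent is [2 l - 64 l * (3 / 64) = - l], which accounts for the number [64 l] of
    sketches. *)
Lemma prob_sketch_large q l X : (3 * q.+1 <= #|X|)%N ->
  prob R (fun w : {ffun 'I_(64 * l) -> sketch_space q} => sketch_count w X < 8 * l)%N
    <= expR (- l%:R).
Proof.
move=> Xq; apply: le_trans (@prob_chernoff R _ _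
  (fun w => - 4^-1 * (sketch_count w X)%:R + 2 * l%:R) _) _.
  by move=> w /ltnW; rewrite -(ler_nat R) natrM; lra.
under eq_avg do rewrite expRD mulrC.
rewrite avgZ avg_sketch_count.
apply: (@le_trans _ _ (expR (2 * l%:R) * expR (- (3 / 64)) ^+ (64 * l))).
  rewrite ler_wpM2l ?expR_ge0//; apply: lerXn2r.
  - by rewrite nnegrE mulr_ge0 ?invr_ge0// sumr_ge0// => w _; exact: expR_ge0.
  - by rewrite nnegrE expR_ge0.
  exact: avg_sketch_large.
by rewrite -expRM_natl -expRD ler_expR natrM; lra.
Qed.

(* A majority-type vote over the sketches separates weight at most [t] from
   weight more than [96 t]; only weights up to [96 t] need interpolation. *)
Lemma approx_base_char (F : fieldType) K l : p \in [pchar F] ->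
  (0 < l)%N -> (0 < K)%N ->
  @approx R F n (l * K) (fun=> expR (- l%:R)) ((64 * p + 96 * K) * l).
Proof.
move=> charF l0 K0; set t := (l * K)%N; pose q := (32 * t).-1.
have t0 : (0 < t)%N by rewrite muln_gt0 l0.
(* With this rate, weight at most [t] meets the hypothesis of [prob_sketch_small], and weight above
   [96 t] that of [prob_sketch_large]. *)
have qE : q.+1 = (32 * t)%N by rewrite /q; lia.
have [A AP] := threshold_interpolation F n (96 * t).
have /choice[N NP] (w : {ffun 'I_(64 * l) -> sketch_space q}) :
    exists f, degle (64 * l * p.-1) f /\
      forall X, f X = (sketch_count w X < 8 * l)%N%:R :> F.
  have [f df fE] := degle_interpolation (fun k => (k < 8 * l)%N%:R : F) 0 (64 * l)
    (fun r => degle_sketch (w r) charF).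
  exists f; split=> // X; apply: fE; rewrite leq0n add0n /=.
  apply: (@leq_trans (\sum_(r < 64 * l) 1)%N); first by apply: leq_sum => r _; exact: leq_b1.
  by rewrite sum_nat_const card_ord muln1.
(* A vote for large weight ([N = 0]) forces the value 1; otherwise [A i] decides. Between [t] and
   [96 t], [A i] is already 1, so either vote is correct. *)
exists {ffun 'I_(64 * l) -> sketch_space q},
  (fun w i X => 1 - N w X * (1 - A i X)); split=> [|w i it|X].
- by rewrite card_ffun expn_gt0 sketch_space_gt0.
- apply: (@degle_weak _ _ (64 * l * p.-1 + 96 * t)).
    by rewrite /t; have := prime_gt0 p_prime; nia.
  apply: degle_sub; first exact: degle_const.
  apply: degle_mul; first exact: (NP w).1.
  by apply: degle_sub; [exact: degle_const|exact: (AP i).1].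
have [Xt|tX] := leqP #|X| t.
  apply: le_trans (prob_sketch_small (q := q) l (X := X) _); last first.
    by rewrite qE leq_mul2l Xt.
  apply: prob_le => w; apply: contraLR; rewrite -ltnNge => S8.
  apply/rightP => i it; rewrite (NP w).2 S8 mul1r subKr.
  by apply: (AP i).2; lia.
have [Xt|Xt] := leqP #|X| (96 * t).
  rewrite (_ : prob _ _ = 0) ?expR_ge0//; rewrite /prob /avg big1 ?mul0r// => w _.
  rewrite (_ : wrong _ _ _ = false)//; apply/negbTE/rightP => i it.
  by rewrite (AP i).2// (leq_trans it (ltnW tX)) subrr mulr0 subr0.
apply: le_trans (prob_sketch_large (q := q) l (X := X) _); last first.
  by rewrite qE; lia.
apply: prob_le => w; apply: contraLR; rewrite -leqNgt => S8.
apply/rightP => i it; rewrite (NP w).2 ltnNge S8 mul0r subr0.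
by rewrite (leq_trans it (ltnW tX)).
Qed.

End PositiveCharacteristic.

(** * From seeds to random polynomial tuples, and the choice of parameters *)

Section Conclusion.
Variables (R : realType) (F : fieldType) (n m : nat).

Section Pushforward.
Variables (T : finType) (Q : T -> poly_tuple F n m).

Let law : {fsfun poly_tuple F n m -> R with 0} :=
  [fsfun P in [fset Q w | w in T]%fset => prob R (fun w => Q w == P) | 0].

Let lawE P : law P = prob R (fun w => Q w == P).
Proof.
rewrite fsfunE; case: ifPn => // /imfsetP QP; apply/esym.
rewrite /prob /avg big1 ?mul0r// => w _; case: eqP => // wP.
by case: QP; exists w.
Qed.

Let law_ge0 P : 0 <= law P.
Proof. by rewrite lawE divr_ge0// sumr_ge0. Qed.

(** Exchanging the sums, each seed [w] contributes exactly once, at [P = Q w]. *)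
Let sum_law (E : pred (poly_tuple F n m)) :
  \sum_(P <- finsupp law | E P) law P = prob R (fun w => E (Q w)).
Proof.
under eq_bigr do rewrite lawE /prob /avg.
rewrite -mulr_suml exchange_big; congr (_ / _); apply: eq_bigr => w _ /=.
have Qw : Q w \in finsupp law.
  rewrite mem_finsupp lawE gt_eqF// divr_gt0//; last first.
    by rewrite ltr0n; apply/card_gt0P; exists w.
  by rewrite (bigD1 w)//= eqxx ltr_wpDr// sumr_ge0.
rewrite big_mkcond (bigD1_seq (Q w)) ?fset_uniq//= eqxx big1 ?addr0; first by case: (E _).
by move=> P /negbTE; rewrite eq_sym => ->; case: (E P).
Qed.

Lemma pushforward_ex : (0 < #|T|)%N -> exists mu : random_poly_tuple R F n m,
  (forall E, Pr mu E = prob R (fun w => E (Q w))) /\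
  (forall P, P \in finsupp mu -> exists w, P = Q w).
Proof.
move=> T0; have law_sum1 : \sum_(P <- finsupp law) law P = 1.
  by rewrite (sum_law predT) /prob /= avg_const.
exists (RandomPolyTuple law_ge0 law_sum1); split=> [E|P]; first exact: sum_law.
rewrite mem_finsupp fsfunE; case: ifPn => [/imfsetP[w _ ->] _|_]; first by exists w.
by rewrite eqxx.
Qed.

End Pushforward.

Lemma approx_has_pdeg_le t d (eps : R) (f : m.-tuple (boolfun n)) :
  threshold_tuple t f -> approx F t (fun _ : {set 'I_n} => eps) d ->
  has_pdeg_le F eps f d.
Proof.
move=> [ts [tst ->]] [T [P [T0 dP eP]]].
have /choice[p pP] (wi : T * 'I_m) : exists p : {mpoly F[n]}, (msize p <= d.+1)%N /\
    forall x : n.-tuple bool, p.@[fun j => (tnth x j)%:R] =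
      P wi.1 (tnth ts wi.2) [set j | tnth x j].
  by have [p sp pE] := degle_mpoly (dP wi.1 _ (tst wi.2)); exists p.
have [mu [muPr musupp]] := pushforward_ex (fun w => [tuple p (w, i) | i < m]) T0.
exists mu; split=> [x|Q /musupp[w ->] i]; last first.
  by rewrite tnth_mktuple; exact: (pP (w, i)).1.
rewrite muPr; apply: le_trans (eP [set j | tnth x j]); apply: prob_le => w.
apply: contraNT => /rightP H; apply/eqP/eq_from_tnth => i.
rewrite !tnth_mktuple (pP (w, i)).2 /= H; last exact: tst.
rewrite /Thr; congr (_ <= _)%N%:R.
rewrite /hamming_weight -sum1_count -sum1_card big_tuple.
by apply: eq_bigl => j; rewrite inE.
Qed.

(** With [L = ln eps^-1] and [y = sqrt (t / L)], take integers [l] and [r] just above [L] and [y],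
    so that [t <= l r ^ 2]. As [eps < 1 / 3] forces [L >= 2 / 3], rounding gives [l <= 3 L], and
    [l r <= 3 L (y + 1) = 3 (sqrt (t L) + L)]; hence [3264 = 3 * 1088]. *)
Lemma pdeg_threshold_le B K t (eps : R) (f : m.-tuple (boolfun n)) :
  (0 < B)%N -> (256 ^ 2 <= K)%N ->
  (forall l, (0 < l)%N ->
    approx F (l * K) (fun _ : {set 'I_n} => expR (- l%:R) : R) (B * l)) ->
  threshold_tuple t f -> 0 < eps -> eps < 3^-1 ->
  (pdeg F eps f)%:R <= 3264 * B%:R * (Num.sqrt (t%:R * ln eps^-1) + ln eps^-1).
Proof.
move=> B0 K256 base ft eps0 eps3; set L := ln eps^-1.
have LE : expR (- L) = eps by rewrite /L lnV ?posrE// opprK lnK ?posrE.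
have L23 : 2 / 3 <= L by have := expR_ge1Dx (- L); rewrite LE; lra.
set y := Num.sqrt (t%:R / L); have y0 : 0 <= y by exact: sqrtr_ge0.
have L0 : 0 < L by lra.
have yL : Num.sqrt (t%:R * L) = L * y.
  rewrite -[in RHS](ger0_norm (ltW L0)) -sqrtr_sqr -sqrtrM ?sqr_ge0//.
  by congr Num.sqrt; field; rewrite gt_eqF.
have y2 : L * y ^+ 2 = t%:R.
  rewrite sqr_sqrtr; last by rewrite divr_ge0// ltW.
  by rewrite mulrC divfK// gt_eqF.
pose l := (Num.trunc L).+1; pose r := (Num.trunc y).+1.
have Ll : L < l%:R by exact: truncnS_gt.
have lL : l%:R <= L + 1 by rewrite -natr1 lerD2r truncn_le ltW.
have yr : y < r%:R by exact: truncnS_gt.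
have ry : r%:R <= y + 1 by rewrite -natr1 lerD2r truncn_le.
have tlr : (t <= l * r ^ 2)%N.
  rewrite -(ler_nat R) -y2 natrM natrX; apply: ler_pM; rewrite ?sqr_ge0 ?ltW//.
  by rewrite ltr_sqr ?nnegrE.
have H := @approx_amplify R F n B K B0 K256 base r l isT isT.
have {}H : has_pdeg_le F eps f (1088 * B * (l * r)).
  apply: approx_has_pdeg_le ft (approx_mono tlr (leqnn _) _ H) => X.
  by rewrite -LE ler_expR lerN2 ltW.
have [_ /(_ _ H)] := pdegP F f (ltW eps0).
rewrite -(ler_nat R) => /le_trans; apply.
rewrite !natrM yL (_ : 3264 * B%:R * _ = 1088 * B%:R * (3 * L * (y + 1))); last by ring.
rewrite ler_wpM2l ?mulr_ge0//; apply: ler_pM => //.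
by lra.
Qed.

(** For [n > 1], [2 ^ (up_log 2 n - 1) < n], and [expR (1 / 2) <= 2] replaces a numerical estimate
    of [ln 2]. *)
Lemma up_log_le_ln : (0 < n)%N -> (up_log 2 n).+1%:R <= 2 * (1 + ln n%:R) :> R.
Proof.
move=> n0; case: (ltnP 1 n) => [n1|n1]; last first.
  have -> : n = 1%N by lia.
  by rewrite up_log1 ln1; lra.
have := up_log_gtn (isT : 1 < 2)%N n1; have := up_log_gt0 2 n; rewrite n1.
case: (up_log 2 n) => //= J _ /ltnW Jn.
have : expR (2^-1 * J%:R) <= expR (ln n%:R) :> R.
  rewrite lnK ?posrE ?ltr0n// expRM_natr; apply: (@le_trans _ _ (2 ^+ J)).
    by apply: lerXn2r; rewrite ?nnegrE ?expR_ge0// expR_half_le2.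
  by rewrite -natrX ler_nat.
by rewrite ler_expR -[J.+2%:R]natr1 -[J.+1%:R]natr1; lra.
Qed.

End Conclusion.

Theorem theorem3p5 (R : realType) :
  (exists (C : R) (k : nat),
    forall (F : fieldType) (n t m : nat) (T : m.-tuple (boolfun n)) (eps : R),
      [pchar F] =i pred0 ->
      (0 < n)%N -> (t <= n)%N -> threshold_tuple t T ->
      0 < eps -> eps < 3^-1 ->
      (pdeg F eps T)%:R <=
        C * (1 + ln n%:R) ^+ k * (Num.sqrt (t%:R * ln eps^-1) + ln eps^-1))
  /\
  (forall p : nat, prime p ->
    exists C : R,
    forall (F : fieldType) (n t m : nat) (T : m.-tuple (boolfun n)) (eps : R),
      p \in [pchar F] ->
      (0 < n)%N -> (t <= n)%N -> threshold_tuple t T ->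
      0 < eps -> eps < 3^-1 ->
      (pdeg F eps T)%:R <=
        C * (Num.sqrt (t%:R * ln eps^-1) + ln eps^-1)).
Proof.
have [K K256] : exists K, (256 ^ 2 <= K)%N by exists (256 ^ 2)%N.
have K0 : (0 < K)%N by apply: leq_trans K256; rewrite expn_gt0.
split=> [|p p_prime].
  pose c : R := (512 * (K + 1))%N%:R.
  (* The exponent 2 comes from the squared number of levels in [approx_base_any], and 4 is the
     square of the constant in [up_log_le_ln]. *)
  exists (3264 * c * 4), 2%N => F n t m T eps _ n0 _ Tt eps0 eps3.
  have base l := @approx_base_any R F n K l ^~ K0.
  have B0 : (0 < 512 * (K + 1) * (up_log 2 n).+1 ^ 2)%N.
    by rewrite !muln_gt0 addn1.
  apply: le_trans (pdeg_threshold_le B0 K256 base Tt eps0 eps3) _.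
  apply: ler_wpM2r.
    rewrite addr_ge0 ?sqrtr_ge0// ln_ge0// invf_ge1//; lra.
  rewrite natrM natrX -/c -!mulrA ler_wpM2l// ler_wpM2l//.
  have -> : 4 * (1 + ln n%:R) ^+ 2 = (2 * (1 + ln n%:R)) ^+ 2 :> R by ring.
  have := up_log_le_ln R n0; set J := _.+1%:R => JL.
  by apply: lerXn2r; rewrite ?nnegrE//; apply: le_trans JL.
exists (3264 * (64 * p + 96 * K)%N%:R) => F n t m T eps charF _ _ Tt eps0 eps3.
have base l := @approx_base_char R n p p_prime F K l charF ^~ K0.
have B0 : (0 < 64 * p + 96 * K)%N by have := prime_gt0 p_prime; lia.
exact: pdeg_threshold_le B0 K256 base Tt eps0 eps3.
Qed.
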